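(* Let $\{S_n\}_{n\ge 0}$ be a sequence of positive reals satisfying $S_n = a(n)S_{n-1} + b(n)S_{n-2}$ for all $n\ge 2$, with real $a(n),b(n)$. Suppose $N$ is a nonnegative integer such that $a(n)>0$ and $b(n)<0$ for all $n\ge N$. If there exist functions $u(n)$ and $v(n)$ such that for all $n\ge N+2$: (i) $\dfrac{a(n)}{2} \le u(n) \le \dfrac{S_n}{S_{n-1}} \le v(n)$; (ii) $4u^3(n) - 3a(n)u^2(n) - a(n+1)b(n) \ge 0$; (iii) $v^4(n) - a(n)v^3(n) - a(n+1)b(n)v(n) - b(n)b(n+1) \le 0$, then $\{S_n\}_{n\ge N}$ is ratio log-concave, that is, for all $n\ge N+2$, $$\left(\frac{S_n}{S_{n-1}}\right)^2 \ge \frac{S_{n-1}}{S_{n-2}}\cdot\frac{S_{n+1}}{S_n}.$$ *)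

(* Defs.v *)
From Stdlib Require Export Reals.
Open Scope R_scope.

(* The tail {S_n}_{n >= N} is ratio log-concave.  The guard on n keeps the
   truncated subtractions n - 1 and n - 2 exact. *)
Definition ratio_log_concave_from (N : nat) (S : nat -> R) : Prop :=
  forall n : nat, (n >= N + 2)%nat ->
    (S n / S (n - 1)%nat) ^ 2
      >= (S (n - 1)%nat / S (n - 2)%nat) * (S (n + 1)%nat / S n).

(* Main.v *)
Require Import Defs.
From Stdlib Require Import Reals Lra Lia Psatz.
Open Scope R_scope.

(** Put x = S_n/S_{n-1} and y = S_{n-1}/S_{n-2}. Since x - a(n) = b(n)/y < 0 and
    S_{n+1}/S_n = a(n+1) + b(n+1)/x, the claim is equivalent to f(x) <= 0 for
    f(t) = t^4 - a(n) t^3 - a(n+1) b(n) t - b(n) b(n+1).  On t >= a(n)/2 the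
    quartic f is convex and, by (ii), f'(u) >= 0; hence f is nondecreasing on
    [u, v], and f(x) <= f(v) <= 0 by (iii). *)

(** The cubic's values at [x] and [u] differ by [x - u] times the quotient in [Hquot], which is 3(2u
    - a)(x + u) + 2(x - u)(2x + u). *)
Lemma quartic_derivative_nonneg (a c u x : R) :
  0 < a -> a / 2 <= u -> u <= x ->
  4 * u ^ 3 - 3 * a * u ^ 2 - c >= 0 ->
  4 * x ^ 3 - 3 * a * x ^ 2 - c >= 0.
Proof.
intros Ha Hau Hux Hu.
assert (Hquot : 0 <= 4 * (x ^ 2 + x * u + u ^ 2) - 3 * a * (x + u)).
{ assert (0 <= (2 * u - a) * (x + u)) by (apply Rmult_le_pos; lra).
  assert (0 <= (x - u) * (2 * x + u)) by (apply Rmult_le_pos; lra).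
  lra. }
assert (0 <= (x - u) * (4 * (x ^ 2 + x * u + u ^ 2) - 3 * a * (x + u)))
  by (apply Rmult_le_pos; lra).
lra.
Qed.

(** To the right of [x] the quartic stays above its tangent at [x], whose slope is nonnegative. *)
Lemma quartic_le (a c d x v : R) :
  0 < a -> a / 2 <= x -> x <= v ->
  4 * x ^ 3 - 3 * a * x ^ 2 - c >= 0 ->
  x ^ 4 - a * x ^ 3 - c * x - d <= v ^ 4 - a * v ^ 3 - c * v - d.
Proof.
intros Ha Hax Hxv Hx.
(* [(v - x) ^ 2] times this factor is the Taylor remainder at [x]. *)
assert (Hrem : 0 <= v ^ 2 + 2 * v * x + 3 * x ^ 2 - a * (v + 2 * x)).
{ assert (0 <= (2 * x - a) * (v + 2 * x)) by (apply Rmult_le_pos; lra).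
  assert (0 <= (v - x) * (v + x)) by (apply Rmult_le_pos; lra).
  lra. }
assert (0 <= (v - x) ^ 2 * (v ^ 2 + 2 * v * x + 3 * x ^ 2 - a * (v + 2 * x)))
  by (apply Rmult_le_pos; [apply pow2_ge_0 | exact Hrem]).
assert (0 <= (4 * x ^ 3 - 3 * a * x ^ 2 - c) * (v - x))
  by (apply Rmult_le_pos; lra).
lra.
Qed.

(** Eliminating [b] and [b'] turns [y] times the quartic into [b * x * (x ^ 2 - y * z)]; as [b * x]
    is negative, the inequality flips. *)
Lemma ratio_sq_ge_of_quartic (a b a' b' x y z : R) :
  b < 0 -> 0 < x -> 0 < y ->
  x * y = a * y + b -> z * x = a' * x + b' ->
  x ^ 4 - a * x ^ 3 - a' * b * x - b * b' <= 0 ->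
  x ^ 2 >= y * z.
Proof.
intros Hb Hx Hy Hxy Hzx Hf.
assert (Hfac : y * (x ^ 4 - a * x ^ 3 - a' * b * x - b * b')
               = b * x * (x ^ 2 - y * z)).
{ replace b' with (z * x - a' * x) by lra.
  replace b with (x * y - a * y) by lra.
  ring. }
assert (0 < - b * x) by (apply Rmult_lt_0_compat; lra).
nra.
Qed.

Theorem theorem4p1 (S a b : nat -> R) (N : nat)
  (S_pos : forall n : nat, S n > 0)
  (S_rec : forall n : nat, (n >= 2)%nat ->
     S n = a n * S (n - 1)%nat + b n * S (n - 2)%nat)
  (ab_sign : forall n : nat, (n >= N)%nat -> a n > 0 /\ b n < 0)
  (uv : exists u v : nat -> R, forall n : nat, (n >= N + 2)%nat ->
     (a n / 2 <= u n /\ u n <= S n / S (n - 1)%nat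
        /\ S n / S (n - 1)%nat <= v n)
     /\ 4 * u n ^ 3 - 3 * a n * u n ^ 2 - a (n + 1)%nat * b n >= 0
     /\ v n ^ 4 - a n * v n ^ 3 - a (n + 1)%nat * b n * v n
          - b n * b (n + 1)%nat <= 0) :
  ratio_log_concave_from N S.
Proof.
destruct uv as [u [v Huv]].
intros n Hn.
destruct (Huv n Hn) as [[Hau [Hux Hxv]] [Hu Hv]].
destruct (ab_sign n ltac:(lia)) as [Ha Hb].
pose proof (S_rec n ltac:(lia)) as Hrec.
pose proof (S_rec (n + 1)%nat ltac:(lia)) as Hrec'.
replace (n + 1 - 1)%nat with n in Hrec' by lia.
replace (n + 1 - 2)%nat with (n - 1)%nat in Hrec' by lia.
pose proof (S_pos n); pose proof (S_pos (n - 1)%nat).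
pose proof (S_pos (n - 2)%nat).
apply (ratio_sq_ge_of_quartic (a n) (b n) (a (n + 1)%nat) (b (n + 1)%nat)).
- exact Hb.
- apply Rdiv_lt_0_compat; lra.
- apply Rdiv_lt_0_compat; lra.
(* Products of consecutive ratios telescope: this is the recurrence at [n] divided by [S (n - 2)],
   and the next goal is the one at [n + 1] divided by [S (n - 1)]. *)
- rewrite Hrec; field; lra.
- rewrite Hrec'; field; lra.
- eapply Rle_trans; [| exact Hv].
  apply quartic_le; try lra.
  apply (quartic_derivative_nonneg _ _ (u n)); lra.
Qed.
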